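(* Let $\lambda, x \in \mathbb{C}$. For every integer $n\ge 0$, $$\frac{B_{n+1}(x+\lambda)-B_{n+1}(x)}{n+1}=\sum_{m=0}^{n}S_2(n,m)\,\lambda^{n-m+1}\beta_m(x\mid\lambda),$$ where $S_2(n,m)$ is the Stirling number of the second kind.
   Context: For $\lambda,x\in\mathbb{C}$ and an integer $n\ge 0$, put $(x\mid\lambda)_n = x(x-\lambda)(x-2\lambda)\cdots(x-(n-1)\lambda)$, with $(x\mid\lambda)_0=1$. As a formal power series in $t$, $(1+\lambda t)^{x/\lambda}=\sum_{n\ge0}(x\mid\lambda)_n\frac{t^n}{n!}$ (for $\lambda=0$ this is read as the limit $e^{xt}$). The Carlitz degenerate Bernoulli polynomials $\beta_n(x\mid\lambda)$ are defined by $$\frac{t}{(1+\lambda t)^{1/\lambda}-1}(1+\lambda t)^{x/\lambda}=\sum_{n=0}^{\infty}\beta_n(x\mid\lambda)\frac{t^n}{n!}.$$ The ordinary Bernoulli polynomials $B_n(x)$ are defined by $\frac{t}{e^t-1}e^{xt}=\sum_{n=0}^\infty B_n(x)\frac{t^n}{n!}$. The Stirling numbers of the second kind satisfy $\frac{(e^t-1)^m}{m!}=\sum_{n=m}^\infty S_2(n,m)\frac{t^n}{n!}$. *)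

(* Defs.v *)
From HB Require Import structures.
From mathcomp Require Import all_boot all_order all_algebra.
From mathcomp Require Import boolp reals complex.

Set Implicit Arguments.
Unset Strict Implicit.
Unset Printing Implicit Defensive.

Import Order.TTheory GRing.Theory Num.Theory.

Local Open Scope ring_scope.

Record fps (F : fieldType) := Fps { fps_coef :> nat -> F }.

HB.instance Definition _ (F : fieldType) := gen_eqMixin (fps F).
HB.instance Definition _ (F : fieldType) := gen_choiceMixin (fps F).

Section FpsRing.
Variable F : fieldType.
Implicit Types f g h : fps F.

Lemma fpsP f g : (forall n, f n = g n) <-> f = g.
Proof.
by split=> [|->//]; case: f g => [f] [g] /= fg; congr Fps; apply: funext.
Qed.

Definition fps_zero : fps F := Fps (fun=> 0).
Definition fps_opp f : fps F := Fps (fun n => - f n).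
Definition fps_add f g : fps F := Fps (fun n => f n + g n).

Lemma fps_addA : associative fps_add.
Proof. by move=> f g h; apply/fpsP => n /=; rewrite addrA. Qed.
Lemma fps_addC : commutative fps_add.
Proof. by move=> f g; apply/fpsP => n /=; rewrite addrC. Qed.
Lemma fps_add0 : left_id fps_zero fps_add.
Proof. by move=> f; apply/fpsP => n /=; rewrite add0r. Qed.
Lemma fps_addN : left_inverse fps_zero fps_opp fps_add.
Proof. by move=> f; apply/fpsP => n /=; rewrite addNr. Qed.

HB.instance Definition _ :=
  GRing.isZmodule.Build (fps F) fps_addA fps_addC fps_add0 fps_addN.

Definition fps_one : fps F := Fps (fun n => (n == 0%N)%:R).
Definition fps_mul f g : fps F :=
  Fps (fun n => \sum_(i < n.+1) f i * g (n - i)%N).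

Definition fps_trunc N f : {poly F} := \poly_(i < N) f i.

Lemma coef_fps_trunc N f n : (n < N)%N -> (fps_trunc N f)`_n = f n.
Proof. by move=> nN; rewrite coef_poly nN. Qed.

Lemma coef_fps_mul N f g n : (n < N)%N ->
  fps_mul f g n = (fps_trunc N f * fps_trunc N g)`_n.
Proof.
move=> nN; rewrite coefM /=; apply: eq_bigr => i _.
by rewrite !coef_fps_trunc ?(leq_ltn_trans (leq_subr _ _)) //;
  apply: leq_ltn_trans nN; rewrite -ltnS.
Qed.

Lemma fps_mulC : commutative fps_mul.
Proof.
by move=> f g; apply/fpsP => n; rewrite !(coef_fps_mul _ _ (ltnSn n)) mulrC.
Qed.

Lemma fps_mulA : associative fps_mul.
Proof.
move=> f g h; apply/fpsP => n.
pose T := fps_trunc n.+1.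
transitivity ((T f * (T g * T h))`_n).
  rewrite coefM /=; apply: eq_bigr => i _.
  by rewrite -(@coef_fps_mul n.+1) ?ltnS ?leq_subr // coef_fps_trunc.
rewrite mulrA coefM /=; apply: eq_bigr => i _.
by rewrite -(@coef_fps_mul n.+1) // coef_fps_trunc ?ltnS ?leq_subr.
Qed.

Lemma fps_mul1 : left_id fps_one fps_mul.
Proof.
move=> f; apply/fpsP => n /=.
by rewrite big_ord_recl big1 => [|i _]; rewrite ?mul0r //= mul1r addr0 subn0.
Qed.

Lemma fps_mulDl : left_distributive fps_mul fps_add.
Proof.
move=> f g h; apply/fpsP => n /=.
by rewrite -big_split; apply: eq_bigr => i _; rewrite mulrDl.
Qed.

Lemma fps_oner_neq0 : fps_one != fps_zero.
Proof. by apply/eqP => /fpsP/(_ 0%N)/eqP; rewrite oner_eq0. Qed.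

HB.instance Definition _ := GRing.Zmodule_isComNzRing.Build (fps F)
  fps_mulA fps_mulC fps_mul1 fps_mulDl fps_oner_neq0.

Lemma fpsD f g n : (f + g) n = f n + g n. Proof. by []. Qed.
Lemma fpsN f n : (- f) n = - f n. Proof. by []. Qed.
Lemma fps0 n : (0 : fps F) n = 0. Proof. by []. Qed.
Lemma fps1 n : (1 : fps F) n = (n == 0%N)%:R. Proof. by []. Qed.
Lemma fpsM f g n : (f * g) n = \sum_(i < n.+1) f i * g (n - i)%N.
Proof. by []. Qed.

(* The first n coefficients of the inverse, by the recurrence
   f 0 * g m = (m == 0)%:R - \sum_(i < m) g i * f (m - i). *)
Fixpoint fps_inv_seq f n : seq F :=
  if n is m.+1 then
    let s := fps_inv_seq f m in
    rcons s (((m == 0%N)%:R - \sum_(i < m) s`_i * f (m - i)%N) / f 0%N)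
  else [::].

Definition fps_unit : {pred fps F} := fun f => f 0%N != 0.
Definition fps_inv f : fps F :=
  if f 0%N != 0 then Fps (fun n => (fps_inv_seq f n.+1)`_n) else f.

Lemma size_fps_inv_seq f n : size (fps_inv_seq f n) = n.
Proof. by elim: n => //= n IHn; rewrite size_rcons IHn. Qed.

Lemma nth_fps_inv_seq f n i : (i < n)%N ->
  (fps_inv_seq f n)`_i = (fps_inv_seq f i.+1)`_i.
Proof.
elim: n => // n IHn; rewrite ltnS leq_eqVlt => /orP[/eqP->//|lt_in].
by rewrite [in LHS]/= nth_rcons size_fps_inv_seq lt_in IHn.
Qed.

Lemma fps_mulVx : {in fps_unit, left_inverse 1 fps_inv *%R}.
Proof.
move=> f; rewrite unfold_in => f0; apply/fpsP => n.
rewrite fpsM fps1 /fps_inv f0 big_ord_recr subnn /=.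
rewrite nth_rcons size_fps_inv_seq ltnn eqxx divfK // addrC.
rewrite -[RHS](addrNK (\sum_(i < n) (fps_inv_seq f n)`_i * f (n - i)%N)).
congr (_ + _); apply: eq_bigr => i _.
by rewrite [in RHS]nth_fps_inv_seq.
Qed.

Lemma fps_unitPl f g : g * f = 1 -> fps_unit f.
Proof.
move/fpsP/(_ 0%N); rewrite fpsM big_ord1 /fps_unit => /eqP gf1.
by apply: contraTneq gf1 => ->; rewrite mulr0 eq_sym oner_eq0.
Qed.

Lemma fps_inv_out : {in [predC fps_unit], fps_inv =1 id}.
Proof.
by move=> f; rewrite inE /= unfold_in /fps_inv => /negPf->.
Qed.

HB.instance Definition _ := GRing.ComNzRing_hasMulInverse.Build (fps F)
  fps_mulVx fps_unitPl fps_inv_out.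

Lemma fps_unitE f : (f \is a GRing.unit) = (f 0%N != 0). Proof. by []. Qed.

Definition fpsX : fps F := Fps (fun n => (n == 1%N)%:R).

Definition fps_shift f : fps F := Fps (fun n => f n.+1).

Lemma fps_shiftK f : f 0%N = 0 -> fps_shift f * fpsX = f.
Proof.
move=> f0; apply/fpsP => -[|n]; first by rewrite fpsM big_ord1 mulr0 f0.
rewrite mulrC fpsM 2!big_ord_recl /= mul0r add0r mul1r subn1 big1 ?addr0 //.
by move=> i _; rewrite mul0r.
Qed.

(* The quotient t / f for f of order exactly 1; such an f is not a unit of the
   ring, so t / f is obtained by cancelling t first. *)
Definition fpsX_over f : fps F := (fps_shift f)^-1.

Lemma fpsX_overK f : f 0%N = 0 -> f 1%N != 0 -> fpsX_over f * f = fpsX.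
Proof.
by move=> f0 f1; rewrite -[X in _ * X]fps_shiftK // mulKr ?fps_unitE.
Qed.

Definition egf (a : nat -> F) : fps F := Fps (fun n => a n / n`!%:R).
Definition egf_coef f (n : nat) : F := n`!%:R * f n.

End FpsRing.

Section Bernoulli.
Variable F : fieldType.
Implicit Types lam x : F.

(* (x | lam)_n *)
Definition degfall lam x (n : nat) : F := \prod_(i < n) (x - i%:R * lam).

(* (1 + lam t)^(x / lam) *)
Definition degexp lam x : fps F := egf (degfall lam x).

(* e^(x t) *)
Definition fpsexp x : fps F := egf (fun n => x ^+ n).

Lemma degexp0 x : degexp 0 x = fpsexp x.
Proof.
apply/fpsP => n /=; rewrite /degfall; under eq_bigr do rewrite mulr0 subr0.
by rewrite prodr_const card_ord.
Qed.

Definition carlitz_bernoulli (n : nat) lam x : F :=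
  egf_coef (fpsX_over (degexp lam 1 - 1) * degexp lam x) n.

Definition bernoulli (n : nat) x : F :=
  egf_coef (fpsX_over (fpsexp 1 - 1) * fpsexp x) n.

Definition stirling2 (n m : nat) : F :=
  egf_coef ((fpsexp 1 - 1) ^+ m / m`!%:R) n.

Lemma degexp1_overK lam :
  fpsX_over (degexp lam 1 - 1) * (degexp lam 1 - 1) = fpsX F.
Proof.
apply: fpsX_overK; rewrite fpsD fpsN fps1 /= /degfall.
  by rewrite big_ord0 divr1 subrr.
by rewrite big_ord1 mul0r !subr0 divr1 oner_neq0.
Qed.

End Bernoulli.

Arguments stirling2 : clear implicits.

(* Main.v *)
(** Write [g = (e^(lam t) - 1) / lam].  Since [g' = 1 + lam g], substituting [g]
    for [t] turns the degenerate exponential [(1 + lam t)^(x / lam)] into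
    [e^(x t)], hence the generating function of the [beta_m(x | lam)] into
    [g e^(x t) / (e^t - 1)].  Multiplied by [lam t] this is
    [(e^(lam t) - 1) * t e^(x t) / (e^t - 1)], the generating function of
    [B_n(x + lam) - B_n(x)]; on the other hand the coefficients of the powers
    of [g] are Stirling numbers up to powers of [lam]. *)
Require Import Defs.
From mathcomp Require Import all_boot all_order all_algebra.
From mathcomp Require Import reals complex ring.

Set Implicit Arguments.
Unset Strict Implicit.
Unset Printing Implicit Defensive.

Import GRing.Theory.
Local Open Scope ring_scope.

(** * Formal power series: dilation, derivative and composition *)

Section FpsTheory.
Variable F : fieldType.
Implicit Types (f g h : fps F) (c : F).

Lemma fpsMn f k n : (f *+ k) n = f n *+ k.
Proof. by elim: k => // k IHk; rewrite !mulrS fpsD IHk. Qed.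

Lemma fps_divn f k n : k%:R != 0 :> F -> (f / k%:R) n = f n / k%:R.
Proof.
move=> k0.
have Uk : (k%:R : fps F) \is a GRing.unit by rewrite fps_unitE fpsMn fps1.
rewrite -[in RHS](divrK Uk f) mulr_natr fpsMn.
by rewrite -(mulr_natr ((f / _) n)) mulfK.
Qed.

Lemma fpsM_scaler c f g h n :
  (forall i, g i = c * h i) -> (f * g) n = c * (f * h) n.
Proof.
by move=> gh; rewrite !fpsM mulr_sumr; apply: eq_bigr => i _; rewrite gh mulrCA.
Qed.

Lemma fpsMX f n : (f * fpsX F) n.+1 = f n.
Proof.
rewrite mulrC fpsM 2!big_ord_recl /= mul0r add0r mul1r subn1 big1 ?addr0 //.
by move=> i _; rewrite mul0r.
Qed.

Lemma fpsMXn f m n : (m <= n)%N -> (f * fpsX F ^+ m) n = f (n - m)%N.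
Proof.
elim: m n => [|m IHm] n; first by rewrite mulr1 subn0.
by case: n => // n mn; rewrite exprSr mulrA fpsMX IHm.
Qed.

(** The power [g ^+ m] has order at least [m], so a composition with [g] is a finite sum in each
    degree. *)
Lemma fps_expr_eq0 g m n : g 0%N = 0 -> (n < m)%N -> (g ^+ m) n = 0.
Proof.
move=> g0; elim: m n => // m IHm n; rewrite ltnS => nm.
rewrite exprS fpsM big_ord_recl g0 mul0r add0r big1 // => i _.
rewrite IHm ?mulr0 // (leq_trans _ nm) //= /bump add1n.
by case: n i {nm} => [[]|n i] //; rewrite subSS ltnS leq_subr.
Qed.

(** The substitution of [c * t] for [t]. *)
Definition fps_dilate c f : fps F := Fps (fun n => c ^+ n * f n).

Lemma fps_dilateM c f g :
  fps_dilate c (f * g) = fps_dilate c f * fps_dilate c g.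
Proof.
apply/fpsP => n; rewrite fpsM /= mulr_sumr; apply: eq_bigr => i _.
by rewrite mulrACA -exprD subnKC // -ltnS.
Qed.

Lemma fps_dilateX c f m : fps_dilate c (f ^+ m) = fps_dilate c f ^+ m.
Proof.
elim: m => [|m IHm]; last by rewrite !exprS fps_dilateM IHm.
by apply/fpsP => -[|n]; rewrite /= ?mulr1 // mulr0.
Qed.

Definition fps_deriv f : fps F := Fps (fun n => n.+1%:R * f n.+1).

Lemma fps_derivE f n : fps_deriv f n = n.+1%:R * f n.+1.
Proof. by []. Qed.

Lemma fps_derivM f g :
  fps_deriv (f * g) = fps_deriv f * g + f * fps_deriv g.
Proof.
apply/fpsP => n; rewrite fpsD /= mulr_sumr.
rewrite (eq_bigr (fun i : 'I_n.+2 => i%:R * f i * g (n.+1 - i)%N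
   + f i * ((n.+1 - i)%:R * g (n.+1 - i)%N))); last first.
  move=> i _; have -> : n.+1%:R = i%:R + (n.+1 - i)%:R :> F.
    by rewrite -natrD subnKC // -ltnS.
  ring.
rewrite big_split /= big_ord_recl /= !mul0r add0r; congr (_ + _).
rewrite big_ord_recr /= subnn mul0r mulr0 addr0; apply: eq_bigr => i _.
by rewrite subSn // -ltnS.
Qed.

Lemma fps_derivX f m :
  fps_deriv (f ^+ m.+1) = f ^+ m * fps_deriv f *+ m.+1.
Proof.
elim: m => [|m IHm]; first by rewrite mul1r.
rewrite exprS fps_derivM IHm mulrnAr mulrA -exprS mulrC.
by rewrite [RHS]mulrS.
Qed.

(* Only meaningful when [g 0 = 0]. *)
Definition fps_comp f g : fps F :=
  Fps (fun n => \sum_(m < n.+1) f m * (g ^+ m) n).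

Lemma fps_comp_widen N f g n : g 0%N = 0 -> (n < N)%N ->
  fps_comp f g n = \sum_(m < N) f m * (g ^+ m) n.
Proof.
move=> g0 nN; rewrite /= (big_ord_widen N (fun m => f m * (g ^+ m) n)) //.
rewrite big_mkcond /=; apply: eq_bigr => m _; case: ltnP => // nm.
by rewrite fps_expr_eq0 // mulr0.
Qed.

(** Both sides expand to one double sum over the square [i, j < N], the powers of [g] combining by
    [exprD]. *)
Lemma fps_compM f h g : g 0%N = 0 ->
  fps_comp (f * h) g = fps_comp f g * fps_comp h g.
Proof.
move=> g0; apply/fpsP => n; pose N := n.+1.
transitivity (\sum_(i < N) \sum_(j < N) f i * h j * (g ^+ (i + j)) n).
  rewrite (@fps_comp_widen N) //.
  under eq_bigr => m _ do rewrite (fpsM f h) mulr_suml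
    (big_ord_widen N (fun i => f i * h (m - i)%N * (g ^+ m) n)) //.
  rewrite (exchange_big_dep xpredT) //=; apply: eq_bigr => i _.
  rewrite -(big_mkord (fun m => (i < m.+1)%N)
    (fun m => f i * h (m - i)%N * (g ^+ m) n)).
  rewrite -(big_mkord xpredT (fun j => f i * h j * (g ^+ (i + j)) n)).
  have iN : (i <= N)%N by apply: ltnW.
  (* Put [m = i + j]. On the left no term has [m < i]; on the right [j >= N - i] forces [i + j > n],
     where the coefficient of the power of [g] is zero. *)
  rewrite (big_cat_nat (n := i)) //= big_nat_cond big_pred0 ?add0r; last first.
    by move=> m; rewrite ltnS; case: ltnP => //; rewrite andbF.
  rewrite [RHS](big_cat_nat (n := (N - i)%N)) ?leq_subr //=.
  rewrite [X in _ = _ + X]big_nat_cond [X in _ = _ + X]big1 ?addr0; last first.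
    move=> j; rewrite andbT => /andP[Nij _].
    by rewrite fps_expr_eq0 ?mulr0 // -leq_subLR.
  rewrite -{1}[val i]add0n big_addn big_nat_cond [RHS]big_nat_cond.
  apply: eq_big => [j|j _]; first by rewrite ltnS leq_addl andbT.
  by rewrite addnK addnC.
rewrite fpsM.
have E k : (k < N)%N -> forall f, fps_comp f g k = \sum_(m < N) f m * (g ^+ m) k.
  by move=> kN f'; apply: fps_comp_widen.
rewrite [RHS](eq_bigr (fun k : 'I_N => \sum_(i < N) \sum_(j < N)
    f i * h j * ((g ^+ i) k * (g ^+ j) (n - k)%N))); last first.
  move=> k _; rewrite !E //; last by rewrite ltnS leq_subr.
  rewrite mulr_suml; apply: eq_bigr => i _.
  by rewrite mulr_sumr; apply: eq_bigr => j _; rewrite mulrACA.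
rewrite [RHS]exchange_big; apply: eq_bigr => i _.
rewrite [RHS]exchange_big; apply: eq_bigr => j _.
by rewrite exprD fpsM mulr_sumr.
Qed.

Lemma fps_compB1 f g : fps_comp (f - 1) g = fps_comp f g - 1.
Proof.
apply/fpsP => n; rewrite fpsD fpsN fps1 /=.
under eq_bigr => m _ do rewrite mulrBl.
rewrite sumrB; congr (_ - _); rewrite big_ord_recl /= mul1r.
by rewrite big1 ?addr0 // => i _; rewrite mul0r.
Qed.

Lemma fps_compX g : g 0%N = 0 -> fps_comp (fpsX F) g = g.
Proof.
move=> g0; apply/fpsP => n; rewrite (@fps_comp_widen n.+2) //.
rewrite 2!big_ord_recl big1 /= ?mul0r ?add0r ?addr0 ?mul1r ?expr1 //.
by move=> i _; rewrite mul0r.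
Qed.

End FpsTheory.

(** * The degenerate exponential under the substitution [degsubst] *)

Section DegenerateExponential.
Variable F : numFieldType.
Implicit Types lam x y : F.

Let natS_neq0 n : n.+1%:R != 0 :> F.
Proof. by rewrite Num.Theory.pnatr_eq0. Qed.

Let fact_neq0 n : n`!%:R != 0 :> F.
Proof. by rewrite Num.Theory.pnatr_eq0 -lt0n fact_gt0. Qed.

Lemma fpsexpD x y : fpsexp (x + y) = fpsexp x * fpsexp y.
Proof.
apply/fpsP => n; rewrite fpsM /= addrC exprDn mulr_suml.
apply: eq_bigr => i _; have le_in : (i <= n)%N by rewrite -ltnS.
rewrite -mulr_natr -(bin_fact le_in) !natrM.
have C0 : 'C(n, i)%:R != 0 :> F by rewrite Num.Theory.pnatr_eq0 -lt0n bin_gt0.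
by field; rewrite C0 !fact_neq0.
Qed.

Lemma degfallS lam x n :
  degfall lam x n.+1 = degfall lam x n * (x - n%:R * lam).
Proof. by rewrite /degfall big_ord_recr. Qed.

(* [(e^(lam t) - 1) / lam], in a form that also makes sense for [lam = 0]. *)
Definition degsubst lam : fps F :=
  fps_dilate lam (fps_shift (fpsexp 1 - 1)) * fpsX F.

Lemma degsubst0 lam : degsubst lam 0%N = 0.
Proof. by rewrite fpsM big_ord1 mulr0. Qed.

Lemma degsubstS lam n : degsubst lam n.+1 = lam ^+ n / n.+1`!%:R.
Proof. by rewrite fpsMX /= expr1n subr0 mul1r. Qed.

Lemma fpsexpB1E lam n : (fpsexp lam - 1) n = lam * degsubst lam n.
Proof.
case: n => [|n]; first by rewrite degsubst0 mulr0 fpsD fpsN fps1 /= divr1 subrr.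
by rewrite degsubstS fpsD fpsN fps1 subr0 mulrA -exprS.
Qed.

(** With [h = (e^t - 1) / t], the two powers are [h(lam t)^m t^m] and [h(t)^m t^m]; both
    coefficients come from degree [n - m] of [h^m]. *)
Lemma degsubstX lam m n : (m <= n)%N ->
  (degsubst lam ^+ m) n = lam ^+ (n - m) * ((fpsexp 1 - 1) ^+ m) n.
Proof.
move=> mn; rewrite exprMn fpsMXn // -fps_dilateX /=.
rewrite -[in RHS](@fps_shiftK _ (fpsexp 1 - 1)).
  by rewrite exprMn fpsMXn.
by rewrite fpsexpB1E degsubst0 mulr0.
Qed.

Lemma fps_deriv_degsubst lam : fps_deriv (degsubst lam) = fpsexp lam.
Proof.
apply/fpsP => n; rewrite fps_derivE degsubstS /= factS natrM.
by field; rewrite fact_neq0 nat1r natS_neq0.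
Qed.

(** The degree [n] coefficient of [(g^(m+1))' = (m+1) g^m g'], where
    [g' = e^(lam t) = 1 + lam g]. *)
Lemma degsubst_ode lam m n :
  n.+1%:R * (degsubst lam ^+ m.+1) n.+1
  = m.+1%:R * ((degsubst lam ^+ m) n + lam * (degsubst lam ^+ m.+1) n).
Proof.
rewrite -fps_derivE fps_derivX fps_deriv_degsubst fpsMn mulr_natl; congr (_ *+ _).
rewrite -[fpsexp lam](subrK 1) mulrDr mulr1 fpsD addrC; congr (_ + _).
by rewrite exprSr; apply: fpsM_scaler => i; rewrite fpsexpB1E.
Qed.

(** Both sides solve [y' = x y] with constant term 1, and in characteristic zero this determines
    every coefficient. *)
Lemma degexp_comp lam x : fps_comp (degexp lam x) (degsubst lam) = fpsexp x.
Proof.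
set f := degexp lam x; set g := degsubst lam.
have g0 : g 0%N = 0 by apply: degsubst0.
(* The equation [(1 + lam t) f' = x f], read on coefficients. *)
have fS m : m.+1%:R * f m.+1 = (x - m%:R * lam) * f m.
  by rewrite /= degfallS factS natrM; field; rewrite fact_neq0 nat1r natS_neq0.
have gS n : n.+1%:R * fps_comp f g n.+1 = x * fps_comp f g n.
  (* The added term [m = 0] has factor zero, and the term in [g ^+ n.+1] has no coefficient of
     degree [n]. *)
  have shift : \sum_(m < n.+1) m.+1%:R * f m.+1 * (g ^+ m.+1) n
             = \sum_(m < n.+1) m%:R * f m * (g ^+ m) n.
    transitivity (\sum_(m < n.+2) m%:R * f m * (g ^+ m) n).
      by rewrite [RHS]big_ord_recl !mul0r add0r.
    by rewrite big_ord_recr /= fps_expr_eq0 // mulr0 addr0.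
  rewrite [in LHS]/fps_comp [LHS]/= big_ord_recl expr0 fps1 mulr0 add0r.
  transitivity (\sum_(m < n.+1) ((x - m%:R * lam) * f m * (g ^+ m) n
      + lam * (m.+1%:R * f m.+1 * (g ^+ m.+1) n))).
    rewrite mulr_sumr; apply: eq_bigr => m _.
    rewrite -[LHS]/(n.+1%:R * (f m.+1 * (g ^+ m.+1) n.+1)).
    rewrite -fS mulrCA degsubst_ode; ring.
  (* After the shift, the sum with factor [lam] cancels the [m%:R * lam] part coming from [fS],
     leaving [x] times the composition. *)
  rewrite big_split -mulr_sumr shift !mulr_sumr -big_split.
  by apply: eq_bigr => m _ /=; ring.
apply/fpsP; elim=> [|n IHn].
  by rewrite /= big_ord1 expr0 /degfall big_ord0 fps1 divr1 mulr1.
apply: (mulfI (natS_neq0 n)); rewrite gS IHn /= factS natrM exprS.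
by field; rewrite fact_neq0 nat1r natS_neq0.
Qed.

(** The non-unit [e^t - 1] is never inverted: if [U] is the composite of the first factor and
    [V = t / (e^t - 1)], then [U (e^t - 1) = g] and [V (e^t - 1) = t] give [U t = g V]. *)
Lemma comp_carlitz_bernoulli_egf lam x :
  fps_comp (fpsX_over (degexp lam 1 - 1) * degexp lam x) (degsubst lam) * fpsX F
  = degsubst lam * (fpsX_over (fpsexp 1 - 1) * fpsexp x).
Proof.
have g0 := degsubst0 lam; rewrite fps_compM // degexp_comp.
have UE : fps_comp (fpsX_over (degexp lam 1 - 1)) (degsubst lam)
    * (fpsexp 1 - 1) = degsubst lam.
  by rewrite -(degexp_comp lam) -fps_compB1 -fps_compM // degexp1_overK
    fps_compX.
have VE : fpsX_over (fpsexp 1 - 1) * (fpsexp 1 - 1) = fpsX F.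
  by rewrite -degexp0 degexp1_overK.
by rewrite -[in RHS]UE -[in LHS]VE; ring.
Qed.

Lemma bernoulli_diff lam x n :
  (bernoulli n.+1 (x + lam) - bernoulli n.+1 x) / n.+1%:R
  = n`!%:R * lam * fps_comp (fpsX_over (degexp lam 1 - 1) * degexp lam x)
                            (degsubst lam) n.
Proof.
(* A factor [t] moves the coefficient from degree [n] to [n.+1], where the previous identity
   applies. *)
rewrite -(fpsMX (fps_comp _ _)) comp_carlitz_bernoulli_egf -[RHS]mulrA.
set V := fpsX_over _.
have -> : lam * (degsubst lam * (V * fpsexp x)) n.+1
    = (V * fpsexp (x + lam)) n.+1 - (V * fpsexp x) n.+1.
  rewrite [degsubst _ * _]mulrC -(fpsM_scaler _ _ (fpsexpB1E lam)).
  by rewrite -fpsN -fpsD fpsexpD; congr (fps_coef _ _); ring.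
by rewrite /bernoulli /egf_coef factS natrM; field; rewrite nat1r natS_neq0.
Qed.

(** The exponent is [n - m] from [degsubstX] plus one from the prefactor [lam]; the [m!] of [egf b]
    is the one in the Stirling series. *)
Lemma stirling2_comp_sum lam (b : nat -> F) n :
  n`!%:R * lam * fps_comp (egf b) (degsubst lam) n
  = \sum_(m < n.+1) stirling2 F n m * lam ^+ (n - m + 1) * b m.
Proof.
rewrite mulr_sumr; apply: eq_bigr => m _.
have le_mn : (m <= n)%N by rewrite -ltnS.
rewrite degsubstX // /stirling2 /egf_coef fps_divn ?fact_neq0 //.
rewrite addn1 exprS /=; ring.
Qed.

Lemma egf_coefK (f : fps F) : egf (egf_coef f) = f.
Proof. by apply/fpsP => n; rewrite /= /egf_coef mulrC mulKf ?fact_neq0. Qed.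

End DegenerateExponential.

Theorem theorem2p5 (R : realType) (lam x : R[i]) (n : nat) :
  (bernoulli n.+1 (x + lam) - bernoulli n.+1 x) / n.+1%:R
  = \sum_(m < n.+1)
      stirling2 R[i] n m * lam ^+ (n - m + 1) * carlitz_bernoulli m lam x.
Proof.
rewrite bernoulli_diff -stirling2_comp_sum; congr (_ * fps_comp _ _ _).
by rewrite egf_coefK.
Qed.
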